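(* Let $(\mathfrak{g},\bullet_{\mathfrak{g}},\langle\;,\;\rangle_{\mathfrak{g}})$ be an $\mathrm{L}$-quadratic left Leibniz algebra such that $\mathrm{Leib}(\mathfrak{g})$ is degenerate and let $(\mathfrak{h},[\;,\;]_{\mathfrak{h}})$ and $(A,\bullet_A,\langle\;,\;\rangle_A)$ be its core. Then $(\mathfrak{g},\bullet_{\mathfrak{g}},\langle\;,\;\rangle_{\mathfrak{g}})$ is isomorphic to $(\mathfrak{h}\oplus A\oplus\mathfrak{h}^*,\bullet,\langle\;,\;\rangle_n)$ where, for any $X,Y\in\mathfrak{h}$, $a,b\in A$, $\alpha\in\mathfrak{h}^*$, the non-vanishing Leibniz products are $$(\ast)\quad\begin{cases}X\bullet Y=[X,Y]_{\mathfrak{h}}+\theta(X,Y)+\Omega(X)^\flat(Y),\quad a\bullet b=a\bullet_A b+\mu(a,b),\\ X\bullet a=F(X)a+\nu(X,a),\quad X\bullet\alpha=(\mathrm{ad}^{\mathfrak{h}}_X)^*\alpha,\quad a\bullet X=G(X)a+\rho(a,X),\end{cases}$$ where $F:\mathfrak{h}\to\mathrm{so}(A)\cap\mathrm{Der}(A)$, $G:\mathfrak{h}\to\mathrm{End}(A)$, $\Omega:\mathfrak{h}\to\wedge^2\mathfrak{h}^*$ are linear maps, $\theta,\omega:\mathfrak{h}\times\mathfrak{h}\to A$ are bilinear maps such that $\omega$ is skew-symmetric, and $\mu,\rho,\nu$ are the $\mathfrak{h}^*$-valued bilinear maps defined by $$(\ast\ast)\quad \rho(a,X)(Y)=-\langle\omega(X,Y),a\rangle_A,\quad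 \mu(a,b)(X)=-\langle G(X)a,b\rangle_A,\quad \nu(X,a)(Y)=-\langle\theta(X,Y),a\rangle_A.$$ Moreover $(F,G,\omega,\theta,\Omega)$ satisfy, for any $X,Y,Z,T\in\mathfrak{h}$ and $a\in A$, $$(\ast\ast\ast)\quad\begin{cases} [\mathrm{L}^A_a,F(X)]=\mathrm{L}^A_{G(X)a},\quad [\mathrm{L}^A_a,G(X)]=\mathrm{R}^A_{G(X)a},\\ \mathrm{L}^A_{\omega(X,Y)}=G(X)^*G(Y)-G(Y)^*G(X),\\ \mathrm{R}^A_{\theta(X,Y)}=[F(X),G(Y)]-G([X,Y]_{\mathfrak{h}})=F(X)G(Y)+G(Y)G(X)-G([X,Y]_{\mathfrak{h}}),\\ \mathrm{L}^A_{\theta(X,Y)}=[F(X),F(Y)]-F([X,Y]_{\mathfrak{h}}),\\ \theta(X,[Y,Z]_{\mathfrak{h}})-\theta([X,Y]_{\mathfrak{h}},Z)-\theta(Y,[X,Z]_{\mathfrak{h}})+F(X)\theta(Y,Z)-F(Y)\theta(X,Z)-G(Z)\theta(X,Y)=0,\\ G(Z)^*\theta(X,Y)-G(Y)^*\theta(X,Z)-F(X)\omega(Y,Z)+\omega(Y,[X,Z]_{\mathfrak{h}})+\omega([X,Y]_{\mathfrak{h}},Z)=0,\\ (G(X)^*+F(X))\omega(Y,Z)=0,\\ \Delta(\Omega)(X,Y)(Z,T)=\langle\theta(X,T),\theta(Y,Z)\rangle_A-\langle\theta(Y,T),\theta(X,Z)\rangle_A-\langle\omega(Z,T),\theta(X,Y)\rangle_A.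 \end{cases}$$ Conversely, if $(A,\bullet_A,\langle\;,\;\rangle_A)$ is an $\mathrm{L}$-quadratic left Leibniz algebra, $(\mathfrak{h},[\;,\;]_{\mathfrak{h}})$ is a Lie algebra and $(F,G,\omega,\theta,\Omega)$ is a list consisting of linear maps $F:\mathfrak{h}\to\mathrm{so}(A)\cap\mathrm{Der}(A)$, $G:\mathfrak{h}\to\mathrm{End}(A)$, $\Omega:\mathfrak{h}\to\wedge^2\mathfrak{h}^*$ and bilinear maps $\theta,\omega:\mathfrak{h}\times\mathfrak{h}\to A$ with $\omega$ skew-symmetric, satisfying $(\ast\ast\ast)$, with $\mu,\rho,\nu$ defined by $(\ast\ast)$, then $(\mathfrak{h}\oplus A\oplus\mathfrak{h}^*,\bullet,\langle\;,\;\rangle_n)$, where $\bullet$ is given by $(\ast)$, is an $\mathrm{L}$-quadratic left Leibniz algebra. It is called the $\mathrm{L}$-quadratic left algebra obtained from $(A,\bullet_A,\langle\;,\;\rangle_A)$ and $(\mathfrak{h},[\;,\;]_{\mathfrak{h}})$ by means of $(F,G,\omega,\theta,\Omega)$.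
   Context: Algebras are real and finite dimensional. Left Leibniz: $u\bullet(v\bullet w)=(u\bullet v)\bullet w+v\bullet(u\bullet w)$. A metric is a nondegenerate symmetric bilinear form; a left Leibniz algebra with a metric is $\mathrm{L}$-quadratic if every left multiplication is skew-symmetric. $\mathrm{Leib}(\mathfrak{g})=\mathrm{span}\{u\bullet v+v\bullet u\}$; it is degenerate if $\mathrm{Leib}(\mathfrak{g})\cap\mathrm{Leib}(\mathfrak{g})^\perp\neq\{0\}$. Isomorphic means by a linear bijection preserving product and metric. Core: put $I=\mathrm{Leib}(\mathfrak{g})\cap\mathrm{Leib}(\mathfrak{g})^\perp$. Then $A=I^\perp/I$, with product and metric induced from $I^\perp$, is an $\mathrm{L}$-quadratic left Leibniz algebra $(A,\bullet_A,\langle\;,\;\rangle_A)$, and $\mathfrak{h}=\mathfrak{g}/I^\perp$ with the quotient product is a Lie algebra ($I^\perp$ is an ideal). These form the core of $\mathfrak{g}$. Notation: $\mathrm{L}^A_a(b)=a\bullet_A b$, $\mathrm{R}^A_a(b)=b\bullet_A a$; $\mathrm{Der}(A)$ is the space of derivations of $(A,\bullet_A)$, $\mathrm{so}(A)$ the space of skew-symmetric endomorphisms of $(A,\langle\;,\;\rangle_A)$; $G(X)^*$ is the adjoint of $G(X)$ with respect to $\langle\;,\;\rangle_A$; $[\;,\;]$ between endomorphisms is the commutator. The natural metric on $\mathfrak{h}\oplus A\oplus\mathfrak{h}^*$ is $\langle X+a+\alpha,X+a+\alpha\rangle_n=2\alpha(X)+\langle a,a\rangle_A$. $((\mathrm{ad}^{\mathfrak{h}}_X)^*\alpha)(Y)=-\alpha([X,Y]_{\mathfrak{h}})$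 for $\alpha\in\mathfrak{h}^*$, and for $\sigma\in\wedge^2\mathfrak{h}^*$, $(\mathrm{ad}_X^*\sigma)(Y,Z)=-\sigma([X,Y]_{\mathfrak{h}},Z)-\sigma(Y,[X,Z]_{\mathfrak{h}})$, and $\sigma^\flat:\mathfrak{h}\to\mathfrak{h}^*$ is $\sigma^\flat(X)(Y)=\sigma(X,Y)$. For $\Omega:\mathfrak{h}\to\wedge^2\mathfrak{h}^*$, $\Delta(\Omega)(X,Y)=\mathrm{ad}_X^*\Omega(Y)-\mathrm{ad}_Y^*\Omega(X)-\Omega([X,Y]_{\mathfrak{h}})$. ''Non-vanishing products'' means that all products of elements of the summands not listed are zero.
   Formalization: Two equations of ( *** ) are corrected, in both directions: L^A_{ω(X,Y)} is replaced by −R^A_{ω(X,Y)}, and (G(X)^*+F(X))ω(Y,Z)=0 by (G(X)^*+F(X)^* )ω(Y,Z)=0, i.e. (G(X)^*−F(X))ω(Y,Z)=0; as printed, the theorem is false. *)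

(* Defs.v *)
From HB Require Import structures.
From mathcomp Require Import all_boot all_order all_algebra.
From mathcomp Require Import boolp classical_sets reals.

Set Implicit Arguments.
Unset Strict Implicit.
Unset Printing Implicit Defensive.

Import GRing.Theory.
Local Open Scope ring_scope.
Local Open Scope quotient_scope.

(* A bilinear map U x V -> W is an element of 'Hom(U, 'Hom(V, W)); for a product
   m, the endomorphism m u is left multiplication by u. *)
Notation product V := 'Hom(V, 'End(V)).

Section Span.
Variables (R : fieldType) (V : vectType R).
Local Open Scope classical_set_scope.

Definition vspan (S : set V) : {vspace V} :=
  xget 0%VS [set U : {vspace V} | (forall v, S v -> v \in U) /\
                     (forall W : {vspace V}, (forall v, S v -> v \in W) ->
                        (U <= W)%VS)].

Lemma vspanP (S : set V) :
  (forall v, S v -> v \in vspan S) /\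
  (forall W : {vspace V}, (forall v, S v -> v \in W) -> (vspan S <= W)%VS).
Proof.
rewrite /vspan; case: xgetP => [U _ [] //|noU]; exfalso.
pose P n := `[< exists2 s : seq V, (forall v, v \in s -> S v) &
                 \dim <<s>>%VS = n >].
have exP : exists n, P n.
  by exists 0%N; apply/asboolP; exists [::] => //; rewrite span_nil dimv0.
have ubP n : P n -> (n <= \dim {:V})%N.
  by move=> /asboolP[s _ <-]; rewrite dimvS ?subvf.
case: (ex_maxnP exP ubP) => n /asboolP[s sS dims] maxn.
apply: (noU <<s>>%VS); split=> [v Sv|W SW]; last first.
  by apply/span_subvP => v /sS /SW.
have vsS w : w \in v :: s -> S w by rewrite inE => /orP[/eqP->|/sS].
have sub : (<<s>> <= <<v :: s>>)%VS by apply: sub_span => w; rewrite inE orbC => ->.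
have /eqP -> : <<s>>%VS == <<v :: s>>%VS.
  by rewrite eqEdim sub dims maxn //; apply/asboolP; exists (v :: s).
by rewrite memv_span ?mem_head.
Qed.

End Span.

Section Quotient.
Variables (R : fieldType) (V : vectType R) (U : {vspace V}).

Definition vquot := {ideal_quot U}.

HB.instance Definition _ := Quotient.on vquot.
HB.instance Definition _ := GRing.Zmodule.on vquot.

Lemma vquot_eqP (x y : V) : reflect (\pi_vquot x = \pi_vquot y) (x - y \in U).
Proof. by rewrite (Quotient.idealrBE U); apply: eqP. Qed.

Lemma vquot_reprP (x : V) : repr (\pi_vquot x) - x \in U.
Proof. by apply/vquot_eqP; rewrite reprK. Qed.

Lemma vquotD (x y : V) : \pi_vquot (x + y) = \pi_vquot x + \pi_vquot y.
Proof. exact: (@pi_addr _ _ _ _ _ {ideal_quot U}). Qed.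

Definition vquot_scale (a : R) (x : vquot) : vquot := \pi_vquot (a *: repr x).

Lemma vquotZ (a : R) (x : V) : \pi_vquot (a *: x) = vquot_scale a (\pi_vquot x).
Proof.
apply/vquot_eqP; rewrite -scalerBr; apply: memvZ.
by rewrite -memvN opprB vquot_reprP.
Qed.

Fact vquot_scaleA a b x : vquot_scale a (vquot_scale b x) = vquot_scale (a * b) x.
Proof.
by elim/quotW: x => x; rewrite -(vquotZ b x) -(vquotZ a) -(vquotZ _ x) scalerA.
Qed.

Fact vquot_scale1 : left_id 1 vquot_scale.
Proof. by elim/quotW => x; rewrite -(vquotZ 1 x) scale1r. Qed.

Fact vquot_scaleDr : right_distributive vquot_scale +%R.
Proof.
move=> a; elim/quotW => x; elim/quotW => y.
by rewrite -(vquotD x y) -(vquotZ a (x + y)) -(vquotZ a x) -(vquotZ a y) scalerDr vquotD.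
Qed.

Fact vquot_scaleDl x : {morph vquot_scale^~ x : a b / a + b}.
Proof.
elim/quotW: x => x a b.
by rewrite -(vquotZ (a + b) x) -(vquotZ a x) -(vquotZ b x) scalerDl vquotD.
Qed.

HB.instance Definition _ := GRing.Zmodule_isLmodule.Build R vquot
  vquot_scaleA vquot_scale1 vquot_scaleDr vquot_scaleDl.

Fact vquot_pi_linear : linear (\pi_vquot : V -> vquot).
Proof. by move=> a x y; rewrite vquotD vquotZ. Qed.

HB.instance Definition _ := GRing.isLinear.Build R V vquot _ (\pi_vquot : V -> vquot)
  vquot_pi_linear.

Definition vquot_compl (x : vquot) : subvs_of (U^C)%VS :=
  vsproj _ (repr x - projv U (repr x)).

Lemma vquot_complE (x : V) : vquot_compl (\pi_vquot x) = vsproj _ (x - projv U x).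
Proof.
have := projv_id (vquot_reprP x); rewrite linearB /= => e.
rewrite /vquot_compl; congr vsproj.
by rewrite -[projv U (repr _)](subrK (projv U x)) e opprD addrA opprB subrKC.
Qed.

Import VectorInternalTheory.

Fact vquot_vect_iso : Vector.axiom (dim (subvs_of (U^C)%VS)) vquot.
Proof.
exists (fun x => v2r (vquot_compl x)).
  move=> a; elim/quotW => x; elim/quotW => y; rewrite -linearP /= !vquot_complE.
  by rewrite -!linearP /= linearP /= scalerBr opprD addrACA.
exists (fun w => \pi_vquot (vsval (r2v w : subvs_of (U^C)%VS))).
  elim/quotW => x; rewrite v2rK vquot_complE vsprojK ?memv_projC //.
  by apply/vquot_eqP; rewrite addrAC subrr add0r memvN memv_proj.
move=> w; rewrite vquot_complE -[RHS]r2vK; congr v2r; rewrite -[RHS]vsvalK.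
congr (vsproj _ _); set y := vsval _.
have : projv U y = y - (y - projv U y) by rewrite opprB addrC subrK.
have yC : y \in (U^C)%VS by apply: subvsP.
move=> e; suff -> : projv U y = 0 by rewrite subr0.
apply/eqP; rewrite -memv0 -(capv_compl U) memv_cap memv_proj e.
by rewrite memvB // memv_projC.
Qed.

HB.instance Definition _ := Lmodule_hasFinDim.Build R vquot vquot_vect_iso.

End Quotient.

Section Algebras.
Variables (R : fieldType) (V : vectType R).
Implicit Types (m : product V) (B : {symmetric V}).

Definition rmul m (u : V) : 'End(V) := linfun (fun v => m v u).

Definition left_leibniz m :=
  forall u v w, m u (m v w) = m (m u v) w + m v (m u w).

Definition lie_algebra m :=
  (forall u, m u u = 0) /\
  (forall u v w, m u (m v w) + m v (m w u) + m w (m u v) = 0).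

Definition derivation m (f : 'End(V)) :=
  forall u v, f (m u v) = m (f u) v + m u (f v).

Definition skew_endo B (f : 'End(V)) := forall u v, B (f u) v = - B u (f v).

Definition L_quadratic m B :=
  [/\ left_leibniz m, nondegenerate B & forall u, skew_endo B (m u)].

Definition commutator (f g : 'End(V)) : 'End(V) := ((f \o g) - (g \o f))%VF.

(* The adjoint is unique, and exists, when B is nondegenerate: see adjointP. *)
Definition adjoint B (f : 'End(V)) : 'End(V) :=
  xget 0 [set g : 'End(V) | forall u v, B (f u) v = B u (g v)]%classic.

Definition Leib m : {vspace V} :=
  vspan [set m u v + m v u | u in setT & v in setT]%classic.

Definition degenerate m B := (Leib m :&: orthov B (Leib m))%VS != 0%VS.

Lemma rmulE m u v : rmul m u v = m v u.
Proof.
pose f v := m v u; have fL : linear f.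
  by move=> a x y; rewrite /f linearP add_lfunE scale_lfunE.
pose F : {linear V -> V} := HB.pack f (GRing.isLinear.Build _ _ _ _ f fL).
exact: (lfunE F v).
Qed.

Lemma adjointP B (f : 'End(V)) : nondegenerate B ->
  forall u v, B (f u) v = B u (adjoint B f v).
Proof.
move=> ndB; rewrite /adjoint; case: xgetP => [g _ //|noadj]; exfalso.
pose flat v : 'Hom(V, R^o) := linfun (B v : V -> R^o).
have flatE u v : flat v u = B v u by rewrite lfunE.
have flatL : linear flat.
  move=> a x y; apply/lfunP => z; rewrite add_lfunE scale_lfunE !flatE.
  exact: linearPl.
pose F0 : {linear V -> 'Hom(V, R^o)} :=
  HB.pack flat (GRing.isLinear.Build _ _ _ _ flat flatL).
pose F := linfun F0.
have FE u v : F v u = B v u by rewrite lfunE /= flatE.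
have kerF : lker F == 0%VS.
  rewrite -subv0; apply/subvP => x; rewrite memv_ker => /eqP x0.
  rewrite -(eqP ndB); apply/mem_orthovP => y _.
  by rewrite -FE x0 lfunE.
have imF : limg F = fullv.
  apply/eqP; rewrite eqEdim subvf /= limg_dim_eq ?(eqP kerF) ?capv0 // !dimvf.
  by rewrite /dim /= muln1.
pose pre (v : V) : V := (F^-1)%VF (F v \o f)%VF.
have FpreE u v : B (pre v) u = B v (f u).
  by rewrite -FE limg_lfunVK ?imF ?memvf // comp_lfunE FE.
have preL : linear pre.
  move=> a x y; rewrite /pre -linearP; congr (_ _); rewrite linearP.
  by rewrite comp_lfunDl comp_lfunZl.
pose G : {linear V -> V} := HB.pack pre (GRing.isLinear.Build _ _ _ _ pre preL).
apply: (noadj (linfun G)) => u v; rewrite lfunE /=.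
by rewrite hermC /= expr0 mul1r -FpreE hermC /= expr0 mul1r.
Qed.

End Algebras.

Section Bilinear.
Variables (R : fieldType) (U V W : vectType R).

(* Meaningful only when f is bilinear: see lfun2E. *)
Definition lfun2 (f : U -> V -> W) : 'Hom(U, 'Hom(V, W)) :=
  linfun (fun u => linfun (f u)).

Lemma lfun2E (f : U -> V -> W) :
    (forall u, linear (f u)) -> (forall v, linear (f^~ v)) ->
  forall u v, lfun2 f u v = f u v.
Proof.
move=> fr fl u v.
pose f1 x : {linear V -> W} := HB.pack (f x) (GRing.isLinear.Build _ _ _ _ (f x) (fr x)).
have f1E x y : linfun (f x) y = f x y := lfunE (f1 x) y.
pose f2 x : 'Hom(V, W) := linfun (f x).
have f2L : linear f2.
  by move=> a x y; apply/lfunP => z; rewrite add_lfunE scale_lfunE !f1E fl.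
pose f3 : {linear U -> 'Hom(V, W)} := HB.pack f2 (GRing.isLinear.Build _ _ _ _ f2 f2L).
by rewrite (lfunE f3 u : lfun2 f u = f2 u) f1E.
Qed.

End Bilinear.

Section Core.
Variables (R : fieldType) (V : vectType R) (m : product V) (B : {symmetric V}).

Definition core_I : {vspace V} := (Leib m :&: orthov B (Leib m))%VS.
Definition core_J : {vspace V} := orthov B core_I.

Definition core_IJ : {vspace (subvs_of core_J)} :=
  (linfun (vsval : subvs_of core_J -> V) @^-1: core_I)%VS.

Definition core_A : vectType R := vquot core_IJ.
Definition core_h : vectType R := vquot core_J.

Definition pi_A (u : subvs_of core_J) : core_A := \pi_(vquot core_IJ) u.
Definition pi_h (u : V) : core_h := \pi_(vquot core_J) u.
Definition repr_A (a : core_A) : subvs_of core_J := repr (a : vquot core_IJ).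
Definition repr_h (X : core_h) : V := repr (X : vquot core_J).

Definition core_form (a b : core_A) : R := B (vsval (repr_A a)) (vsval (repr_A b)).

Lemma core_formE u v : core_form (pi_A u) (pi_A v) = B (vsval u) (vsval v).
Proof.
have key (x : subvs_of core_J) : vsval (repr_A (pi_A x)) - vsval x \in core_I.
  have := vquot_reprP core_IJ x; rewrite -memv_preim lfunE.
  exact.
have orth x x' (y : subvs_of core_J) :
    x - x' \in core_I -> B x (vsval y) = B x' (vsval y).
  move=> xI; have /mem_orthovP/(_ _ xI) := subvsP y.
  rewrite hermC /= expr0 mul1r linearBl => /eqP.
  by rewrite subr_eq0 => /eqP.
rewrite /core_form (orth _ _ _ (key u)) hermC /= (orth _ _ _ (key v)).
by rewrite expr0 mul1r hermC /= expr0 mul1r.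
Qed.

Fact core_form_bilinear : bilinear_for *%R *%R core_form.
Proof.
have pi_lin a x y : pi_A (a *: x + y) = a *: pi_A x + pi_A y :=
  vquot_pi_linear core_IJ a x y.
by split; elim/(@quotW _ (vquot core_IJ)) => x a; elim/(@quotW _ (vquot core_IJ)) => y;
   elim/(@quotW _ (vquot core_IJ)) => z;
   rewrite -[\pi x]/(pi_A x) -[\pi y]/(pi_A y) -[\pi z]/(pi_A z)
     -pi_lin !core_formE linearP ?linearPl ?linearPr.
Qed.

HB.instance Definition _ :=
  bilinear_isBilinear.Build R core_A core_A R *%R *%R core_form core_form_bilinear.

Fact core_form_sym a b : core_form a b = (-1) ^+ false * idfun (core_form b a).
Proof. by rewrite expr0 mul1r /core_form hermC /= expr0 mul1r. Qed.

HB.instance Definition _ :=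
  isHermitianSesquilinear.Build R core_A false idfun core_form core_form_sym.

Definition core_mul : product core_A :=
  lfun2 (fun a b => pi_A (vsproj core_J (m (vsval (repr_A a)) (vsval (repr_A b))))).

Definition core_br : product core_h :=
  lfun2 (fun X Y => pi_h (m (repr_h X) (repr_h Y))).

Section WellDefined.
Hypothesis mB : L_quadratic m B.

Let mL := let: And3 h _ _ := mB in h.
Let Bnd := let: And3 _ h _ := mB in h.
Let mS u : skew_endo B (m u) := let: And3 _ _ h := mB in h u.

Lemma formC u v : B u v = B v u.
Proof. by rewrite hermC /= expr0 mul1r. Qed.

Lemma mem_Leib u v : m u v + m v u \in Leib m.
Proof. by apply: (vspanP _).1; exists u => //; exists v. Qed.

Lemma Leib_sub (W : {vspace V}) :
  (forall u v, m u v + m v u \in W) -> (Leib m <= W)%VS.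
Proof. by move=> mW; apply: (vspanP _).2 => _ [u _ [v _ <-]]. Qed.

Lemma Leib_mul0 x v : x \in Leib m -> m x v = 0.
Proof.
have: (Leib m <= lker m)%VS.
  apply: Leib_sub => a b; rewrite memv_ker; apply/eqP/lfunP => c.
  have e p q : m (m p q) c = m p (m q c) - m q (m p c) by rewrite mL addrK.
  by rewrite linearD add_lfunE !e lfunE /= addrA subrK subrr.
by move/subvP => sub /sub; rewrite memv_ker => /eqP ->; rewrite lfunE.
Qed.

Lemma Leib_mull u x : x \in Leib m -> m u x \in Leib m.
Proof.
suff /subvP sub : (Leib m <= m u @^-1: Leib m)%VS.
  by move=> /sub; rewrite -memv_preim.
apply: Leib_sub => a b; rewrite -memv_preim linearD /= (mL u a b) (mL u b a).
by rewrite [X in _ + X]addrC addrACA memvD // mem_Leib.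
Qed.

Lemma core_I_mull u x : x \in core_I -> m u x \in core_I.
Proof.
rewrite !memv_cap => /andP[xL /mem_orthovP xO]; rewrite Leib_mull //=.
by apply/mem_orthovP => l lL; rewrite mS xO ?oppr0 // Leib_mull.
Qed.

Lemma core_I_mul0 u x : x \in core_I -> m x u = 0.
Proof. by rewrite memv_cap => /andP[/Leib_mul0 ->]. Qed.

Lemma core_J_mull u x : x \in core_J -> m u x \in core_J.
Proof.
move=> /mem_orthovP xJ; apply/mem_orthovP => y yI.
by rewrite mS xJ ?oppr0 // core_I_mull.
Qed.

Lemma core_J_mulI u x : u \in core_J -> x \in core_I -> m u x = 0.
Proof.
move=> /mem_orthovP uJ xI; apply/eqP; rewrite -memv0 -(eqP Bnd).
apply/mem_orthovP => y _; move: (xI); rewrite memv_cap => /andP[_ /mem_orthovP xO].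
have /eqP := xO _ (mem_Leib u y); rewrite linearDr /= addr_eq0 => /eqP e.
rewrite mS e opprK; apply/eqP; rewrite -oppr_eq0; apply/eqP.
by rewrite -mS formC uJ // core_I_mull.
Qed.

Lemma core_J_mulr u x : x \in core_J -> m x u \in core_J.
Proof.
move=> xJ; apply/mem_orthovP => y yI.
by rewrite mS core_J_mulI // linear0r oppr0.
Qed.

Lemma core_mulE u v :
  core_mul (pi_A u) (pi_A v) = pi_A (vsproj core_J (m (vsval u) (vsval v))).
Proof.
pose f (u v : subvs_of core_J) := pi_A (vsproj core_J (m (vsval u) (vsval v))).
pose g a b := f (repr_A a) (repr_A b).
have pi_lin a x y : pi_A (a *: x + y) = a *: pi_A x + pi_A y :=
  vquot_pi_linear core_IJ a x y.
have key (x : subvs_of core_J) : vsval (repr_A (pi_A x)) - vsval x \in core_I.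
  by have := vquot_reprP core_IJ x; rewrite -memv_preim lfunE.
have fr w : linear (f w) by move=> a x y; rewrite /f !linearP -pi_lin.
have fl w : linear (f^~ w).
  by move=> a x y; rewrite /f !linearP add_lfunE scale_lfunE linearP -pi_lin.
have gE x y : g (pi_A x) (pi_A y) = f x y.
  rewrite /g /f; set x' := repr_A _; set y' := repr_A _.
  apply/(vquot_eqP core_IJ); rewrite -memv_preim lfunE /=.
  rewrite !vsprojK ?core_J_mulr ?subvsP //.
  have -> : m (vsval x') (vsval y') - m (vsval x) (vsval y)
          = m (vsval x' - vsval x) (vsval y') + m (vsval x) (vsval y' - vsval y).
    by rewrite linearB add_lfunE opp_lfunE linearB addrA subrK.
  by rewrite core_I_mul0 ?key // add0r core_I_mull ?key.
rewrite /core_mul -/g lfun2E ?gE //.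
  move=> a c; elim/(@quotW _ (vquot core_IJ)): a => a x.
  elim/(@quotW _ (vquot core_IJ)): x => x; elim/(@quotW _ (vquot core_IJ)) => y.
  by rewrite -[LHS]/(g (pi_A a) (c *: pi_A x + pi_A y)) -pi_lin gE fr -!gE.
move=> a c; elim/(@quotW _ (vquot core_IJ)): a => a x.
elim/(@quotW _ (vquot core_IJ)): x => x; elim/(@quotW _ (vquot core_IJ)) => y.
by rewrite -[LHS]/(g (c *: pi_A x + pi_A y) (pi_A a)) -pi_lin gE fl -!gE.
Qed.

Lemma core_brE u v : core_br (pi_h u) (pi_h v) = pi_h (m u v).
Proof.
pose f u v := pi_h (m u v).
pose g a b := f (repr_h a) (repr_h b).
have pi_lin a x y : pi_h (a *: x + y) = a *: pi_h x + pi_h y :=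
  vquot_pi_linear core_J a x y.
have key x : repr_h (pi_h x) - x \in core_J by apply: vquot_reprP.
have fr w : linear (f w) by move=> a x y; rewrite /f !linearP -pi_lin.
have fl w : linear (f^~ w).
  by move=> a x y; rewrite /f !linearP add_lfunE scale_lfunE -pi_lin.
have gE x y : g (pi_h x) (pi_h y) = f x y.
  rewrite /g /f; set x' := repr_h _; set y' := repr_h _.
  apply/(vquot_eqP core_J).
  have -> : m x' y' - m x y = m (x' - x) y' + m x (y' - y).
    by rewrite linearB add_lfunE opp_lfunE linearB addrA subrK.
  by apply: memvD; [apply/core_J_mulr/key | apply/core_J_mull/key].
rewrite /core_br -/g lfun2E ?gE //.
  move=> a c; elim/(@quotW _ (vquot core_J)): a => a x.
  elim/(@quotW _ (vquot core_J)): x => x; elim/(@quotW _ (vquot core_J)) => y.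
  by rewrite -[LHS]/(g (pi_h a) (c *: pi_h x + pi_h y)) -pi_lin gE fr -!gE.
move=> a c; elim/(@quotW _ (vquot core_J)): a => a x.
elim/(@quotW _ (vquot core_J)): x => x; elim/(@quotW _ (vquot core_J)) => y.
by rewrite -[LHS]/(g (c *: pi_h x + pi_h y) (pi_h a)) -pi_lin gE fl -!gE.
Qed.

End WellDefined.

End Core.

Arguments core_form {R V} m B a b.

Section Extension.
Variables (R : fieldType) (h A : vectType R).
Variables (br : product h) (mA : product A) (BA : {symmetric A}).

Local Notation dual := 'Hom(h, R^o).
Local Notation ext := (h * A * dual)%type.

Implicit Types (X Y Z T : h) (a b : A) (alpha : dual).

Definition ad_dual X alpha : dual := - (alpha \o br X)%VF.

(* An element sigma of /\^2 h^* is encoded by sigma^flat : h -> h^*, that is,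
   sigma X Y stands for sigma (X, Y). *)
Definition alternating (sigma : 'Hom(h, dual)) := forall X Y, sigma X Y = - sigma Y X.

Definition ad_form X (sigma : 'Hom(h, dual)) Y Z : R :=
  - sigma (br X Y) Z - sigma Y (br X Z).

Variables (F G : 'Hom(h, 'End(A))) (om th : 'Hom(h, 'Hom(h, A))).
Variable Om : 'Hom(h, 'Hom(h, dual)).

Definition Delta X Y Z T : R :=
  ad_form X (Om Y) Z T - ad_form Y (Om X) Z T - Om (br X Y) Z T.

(* The maps under linfun are linear: see rhoE, muE and nuE. *)
Definition rho a X : dual := linfun (fun Y => - BA (om X Y) a : R^o).
Definition mu a b : dual := linfun (fun X => - BA (G X a) b : R^o).
Definition nu X a : dual := linfun (fun Y => - BA (th X Y) a : R^o).

Definition ext_prod (u v : ext) : ext :=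
  let: (X, a, alpha) := u in let: (Y, b, beta) := v in
  (br X Y,
   th X Y + mA a b + F X b + G Y a,
   Om X Y + mu a b + nu X b + ad_dual X beta + rho a Y).

Definition ext_mul : product ext := lfun2 ext_prod.

(* The polarization of X + a + alpha |-> 2 alpha X + <a, a>. *)
Definition ext_form (u v : ext) : R :=
  let: (X, a, alpha) := u in let: (Y, b, beta) := v in
  alpha Y + beta X + BA a b.

Definition ext_data :=
  [/\ forall X, skew_endo BA (F X), forall X, derivation mA (F X),
      forall X Y, om X Y = - om Y X & forall X, alternating (Om X)].

(* R_om and kill_om depart from the usual printed form of this system, which has
   L_(om X Y) instead of - R_(om X Y) and F(X) instead of its adjoint
   F(X)^* = - F(X). The printed form fails in both directions of the equivalence
   with the Leibniz identity: the forms below are the a, b, X component of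
   a.(b.X) = (a.b).X + b.(a.X), and the component of (X.a + a.X).Y = 0. The two
   versions of R_om agree when A is a Lie algebra. *)
Record ext_compatible : Prop := ExtCompatible {
  commLF : forall X a, commutator (mA a) (F X) = mA (G X a);
  commLG : forall X a, commutator (mA a) (G X) = rmul mA (G X a);
  R_om : forall X Y, - rmul mA (om X Y) =
    ((adjoint BA (G X) \o G Y) - (adjoint BA (G Y) \o G X))%VF;
  R_th : forall X Y, rmul mA (th X Y) = commutator (F X) (G Y) - G (br X Y);
  R_th' : forall X Y, rmul mA (th X Y) =
    ((F X \o G Y) + (G Y \o G X))%VF - G (br X Y);
  L_th : forall X Y, mA (th X Y) = commutator (F X) (F Y) - F (br X Y);
  cocycle_th : forall X Y Z,
    th X (br Y Z) - th (br X Y) Z - th Y (br X Z)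
      + F X (th Y Z) - F Y (th X Z) - G Z (th X Y) = 0;
  cocycle_om : forall X Y Z,
    adjoint BA (G Z) (th X Y) - adjoint BA (G Y) (th X Z) - F X (om Y Z)
      + om Y (br X Z) + om (br X Y) Z = 0;
  kill_om : forall X Y Z, (adjoint BA (G X) + adjoint BA (F X)) (om Y Z) = 0;
  Delta_Om : forall X Y Z T,
    Delta X Y Z T = BA (th X T) (th Y Z) - BA (th Y T) (th X Z) - BA (om Z T) (th X Y) }.

Lemma rhoE a X Y : rho a X Y = - BA (om X Y) a.
Proof.
pose f Y := - BA (om X Y) a : R^o.
have fL : linear f by move=> c x y; rewrite /f linearP linearPl opprD -mulrN.
exact: (lfunE (HB.pack f (GRing.isLinear.Build _ _ _ _ f fL) : {linear h -> R^o})).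
Qed.

Lemma muE a b X : mu a b X = - BA (G X a) b.
Proof.
pose f X := - BA (G X a) b : R^o.
have fL : linear f.
  by move=> c x y; rewrite /f linearP add_lfunE scale_lfunE linearPl opprD -mulrN.
exact: (lfunE (HB.pack f (GRing.isLinear.Build _ _ _ _ f fL) : {linear h -> R^o})).
Qed.

Lemma nuE X a Y : nu X a Y = - BA (th X Y) a.
Proof.
pose f Y := - BA (th X Y) a : R^o.
have fL : linear f by move=> c x y; rewrite /f linearP linearPl opprD -mulrN.
exact: (lfunE (HB.pack f (GRing.isLinear.Build _ _ _ _ f fL) : {linear h -> R^o})).
Qed.

Fact addr4ACA (W : zmodType) (p1 q1 p2 q2 p3 q3 p4 q4 : W) :
  (p1 + q1) + (p2 + q2) + (p3 + q3) + (p4 + q4) =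
  (p1 + p2 + p3 + p4) + (q1 + q2 + q3 + q4).
Proof. by rewrite (addrACA p1) (addrACA _ _ p3) (addrACA _ _ p4). Qed.

Fact addr5ACA (W : zmodType) (p1 q1 p2 q2 p3 q3 p4 q4 p5 q5 : W) :
  (p1 + q1) + (p2 + q2) + (p3 + q3) + (p4 + q4) + (p5 + q5) =
  (p1 + p2 + p3 + p4 + p5) + (q1 + q2 + q3 + q4 + q5).
Proof. by rewrite (addr4ACA p1 q1 p2) (addrACA _ _ p5). Qed.

Fact oppr_lin (c x y : R) : - (c * x + y) = c * - x + - y.
Proof. by rewrite opprD mulrN. Qed.

Lemma ext_mulE u v : ext_mul u v = ext_prod u v.
Proof.
rewrite /ext_mul lfun2E //.
  move=> [[X a] alpha] c [[Y b] beta] [[Y' b'] beta'].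
  have muD : mu a (c *: b + b') = c *: mu a b + mu a b'.
    apply/lfunP => Z; rewrite add_lfunE scale_lfunE !muE linearPr; exact: oppr_lin.
  have nuD : nu X (c *: b + b') = c *: nu X b + nu X b'.
    apply/lfunP => Z; rewrite add_lfunE scale_lfunE !nuE linearPr; exact: oppr_lin.
  have rhoD : rho a (c *: Y + Y') = c *: rho a Y + rho a Y'.
    apply/lfunP => Z; rewrite add_lfunE scale_lfunE !rhoE linearP add_lfunE.
    by rewrite scale_lfunE linearPl; exact: oppr_lin.
  have adD : ad_dual X (c *: beta + beta') = c *: ad_dual X beta + ad_dual X beta'.
    by rewrite /ad_dual comp_lfunDl -comp_lfunZl opprD scalerN.
  rewrite -[LHS]/(ext_prod (X, a, alpha) (c *: Y + Y', c *: b + b', c *: beta + beta')).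
  rewrite /ext_prod muD nuD rhoD adD; congr (_, _, _); first exact: linearP.
    by rewrite !linearP add_lfunE scale_lfunE addr4ACA -!scalerDr.
  by rewrite linearP addr5ACA -!scalerDr.
move=> [[Y b] beta] c [[X a] alpha] [[X' a'] alpha'].
have muD : mu (c *: a + a') b = c *: mu a b + mu a' b.
  apply/lfunP => Z; rewrite add_lfunE scale_lfunE !muE linearP linearPl.
  exact: oppr_lin.
have nuD : nu (c *: X + X') b = c *: nu X b + nu X' b.
  apply/lfunP => Z; rewrite add_lfunE scale_lfunE !nuE linearP add_lfunE.
  by rewrite scale_lfunE linearPl; exact: oppr_lin.
have rhoD : rho (c *: a + a') Y = c *: rho a Y + rho a' Y.
  apply/lfunP => Z; rewrite add_lfunE scale_lfunE !rhoE linearPr; exact: oppr_lin.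
have adD : ad_dual (c *: X + X') beta = c *: ad_dual X beta + ad_dual X' beta.
  by rewrite /ad_dual linearP comp_lfunDr -comp_lfunZr opprD scalerN.
rewrite -[LHS]/(ext_prod (c *: X + X', c *: a + a', c *: alpha + alpha') (Y, b, beta)).
rewrite /ext_prod muD nuD rhoD adD; congr (_, _, _).
- by rewrite linearP add_lfunE scale_lfunE.
- by rewrite !linearP !add_lfunE !scale_lfunE addr4ACA -!scalerDr.
- by rewrite linearP add_lfunE scale_lfunE addr5ACA -!scalerDr.
Qed.

Fact ext_form_bilinear : bilinear_for *%R *%R ext_form.
Proof.
split=> [[[Y b] beta]|[[Y b] beta]] c [[X a] alpha] [[X' a'] alpha'].
  rewrite -[LHS]/(ext_form (c *: X + X', c *: a + a', c *: alpha + alpha') (Y, b, beta)).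
  rewrite /ext_form add_lfunE scale_lfunE linearP linearPl.
  by rewrite (addrACA (c *: alpha Y)) (addrACA _ _ (c * BA a b)) -!mulrDr.
rewrite -[LHS]/(ext_form (Y, b, beta) (c *: X + X', c *: a + a', c *: alpha + alpha')).
rewrite /ext_form add_lfunE scale_lfunE linearP linearPr.
by rewrite (addrACA (c *: beta X)) (addrACA _ _ (c * BA b a)) -!mulrDr.
Qed.

HB.instance Definition _ :=
  bilinear_isBilinear.Build R ext ext R *%R *%R ext_form ext_form_bilinear.

Fact ext_form_sym u v : ext_form u v = (-1) ^+ false * idfun (ext_form v u).
Proof.
case: u v => [[X a] alpha] [[Y b] beta] /=.
by rewrite expr0 mul1r addrC [beta X + _]addrC addrC hermC /= expr0 mul1r.
Qed.

HB.instance Definition _ :=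
  isHermitianSesquilinear.Build R ext false idfun ext_form ext_form_sym.

Lemma ext_form_diag X a alpha :
  ext_form (X, a, alpha) (X, a, alpha) = 2 * alpha X + BA a a.
Proof. by rewrite /ext_form mulr_natl mulr2n. Qed.

End Extension.

Arguments ext_form {R} h {A} BA u v.

Definition isomorphic (R : fieldType) (V W : vectType R) (mV : product V)
    (BV : {symmetric V}) (mW : product W) (BW : {symmetric W}) :=
  exists phi : 'Hom(V, W), [/\ bijective phi,
    forall u v, phi (mV u v) = mW (phi u) (phi v) & isometry BW BV phi].

(* Main.v *)
Require Import Defs.
From HB Require Import structures.
From mathcomp Require Import all_boot all_order all_algebra.
From mathcomp Require Import reals.
From mathcomp Require Import boolp ring.

Set Implicit Arguments.
Unset Strict Implicit.
Unset Printing Implicit Defensive.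

Import GRing.Theory.
Local Open Scope ring_scope.

(** Both halves of the theorem rest on one equivalence, [ext_L_quadratic]: the
    product on [h + A + h^*] is L-quadratic if and only if [br] satisfies the left
    Leibniz identity, [A] is L-quadratic and [(F, G, om, th, Om)] satisfies
    [ext_data] and [ext_compatible].

    That equivalence is a computation made short by trilinearity: the Leibniz
    identity only has to be tested on elements of the summands. It is automatic, or
    equivalent to the Leibniz identity of [br], as soon as one of the three elements
    lies in [h^*]; the eight remaining types of triples give, component by component,
    the structure equations. An equation in [h^*] is read after evaluation at a
    vector of [h], and becomes an equation in [A] by skew-symmetry and
    nondegeneracy of the metric of [A]. The triples of types [(A, h, h)] and
    [(h, A, h)] give two versions of the same equation: the latter is [cocycle_om]
    and their difference is [kill_om].

    The converse half of the theorem is then immediate. For the direct half, put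
    [I = Leib g :&: (Leib g)^perp], which is isotropic, and [J = I^perp]. As the
    metric is nondegenerate, [J^perp = I], the metric of [J / I] is nondegenerate and
    [I] is the dual of [h = g / J]. A Witt decomposition ([witt_splitting]) writes
    [g] as the sum of an isotropic copy of [h], an orthogonal copy of [A = J / I] and
    [I = h^*]. As [I] acts by zero on the left, all products are determined by their
    pairings with the first two summands, and the invariance of the metric shows that
    only five of these pairings are free: they define [F], [G], [om], [th] and [Om],
    through the Riesz representation ([splitting_isomorphic]). So [g] is isomorphic
    to an extension, which is therefore L-quadratic, and the equivalence gives the
    structure equations. *)

(** * Symmetric forms and linear maps *)

Section Forms.
Variables (R : fieldType) (V : vectType R) (B : {symmetric V}).

Lemma symC u v : B u v = B v u.
Proof. by rewrite hermC /= expr0 mul1r. Qed.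

Lemma formDl u v w : B (u + v) w = B u w + B v w.
Proof. exact: linearDl. Qed.

Lemma formNl u v : B (- u) v = - B u v.
Proof. exact: linearNl. Qed.

Lemma formDr u v w : B w (u + v) = B w u + B w v.
Proof. exact: linearDr. Qed.

Lemma formNr u v : B v (- u) = - B v u.
Proof. exact: linearNr. Qed.

Lemma formZl c u v : B (c *: u) v = c * B u v.
Proof. exact: linearZl_LR. Qed.

Lemma formZr c u v : B v (c *: u) = c * B v u.
Proof. exact: linearZr_LR. Qed.

Definition formE := (formDl, formNl, formDr, formNr).

Lemma nondegenerateP :
  nondegenerate B <-> forall u, (forall v, B u v = 0) -> u = 0.
Proof.
split=> [/eqP ndB u u0|ndB].
  by apply/eqP; rewrite -memv0 -ndB; apply/mem_orthovP => v _.
rewrite /nondegenerate -subv0; apply/subvP => u /mem_orthovP u0.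
by rewrite memv0; apply/eqP/ndB => v; rewrite u0 ?memvf.
Qed.

Hypothesis ndB : nondegenerate B.

Lemma form_inj u v : (forall w, B u w = B v w) -> u = v.
Proof.
move=> uv; apply/eqP; rewrite -subr_eq0; apply/eqP.
by apply: (nondegenerateP.1 ndB) => w; rewrite linearBl /= uv subrr.
Qed.

Lemma lfun_formP (f g : 'End(V)) :
  f = g <-> forall u v, B (f u) v = B (g u) v.
Proof. by split=> [-> //|e]; apply/lfunP => u; apply: form_inj => v. Qed.

Lemma adjoint_formE (f : 'End(V)) u v : B (adjoint B f u) v = B u (f v).
Proof. by rewrite symC -adjointP // symC. Qed.

End Forms.

Lemma lfun0l (R : fieldType) (U V W : vectType R) (f : 'Hom(U, 'Hom(V, W))) v :
  f 0 v = 0.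
Proof. by rewrite linear0 zero_lfunE. Qed.

Lemma lfun_of_linear (R : fieldType) (U V : vectType R) (f : U -> V) :
  linear f -> exists g : 'Hom(U, V), forall u, g u = f u.
Proof.
move=> fL; pose F : {linear U -> V} := HB.pack f (GRing.isLinear.Build _ _ _ _ f fL).
by exists (linfun F) => u; rewrite lfunE.
Qed.

Lemma linear_section (R : fieldType) (U V : vectType R) (f : 'Hom(U, V)) :
  (forall v, exists u, f u = v) -> exists g : 'Hom(V, U), forall v, f (g v) = v.
Proof.
move=> f_surj; exists (f^-1)%VF => v; rewrite limg_lfunVK //.
by have [u <-] := f_surj v; rewrite memv_img ?memvf.
Qed.

Lemma dual_separates (R : fieldType) (V : vectType R) (v : V) :
  (forall f : 'Hom(V, R^o), f v = 0) -> v = 0.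
Proof.
move=> v0; rewrite (coord_vbasis (memvf v)) big1 // => i _.
have := v0 (linfun (coord (vbasis fullv) i : V -> R^o)).
by rewrite lfunE /= => ->; rewrite scale0r.
Qed.

(** The Leibniz identity and the structure equations are rearrangements of each
    other; comparing differences reduces such an equivalence to a ring identity. *)
Lemma eq_iff_sub (W : zmodType) (x y x' y' : W) :
  x - y = x' - y' -> (x = y <-> x' = y').
Proof.
move=> e; have eqb : (x == y) = (x' == y') by rewrite -subr_eq0 e subr_eq0.
by split=> /eqP xy; apply/eqP; [rewrite -eqb | rewrite eqb].
Qed.

Lemma eq_iff_subN (W : zmodType) (x y x' y' : W) :
  x - y = y' - x' -> (x = y <-> x' = y').
Proof. by move=> e; have [xy yx] := eq_iff_sub e; split=> [/xy|/esym/yx]. Qed.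

(** * Riesz representation *)

Section Riesz.
Variables (R : fieldType) (V : vectType R) (B : {symmetric V}).

(** The existence of adjoints already contains the Riesz representation: apply it to
    an endomorphism of rank one with the given functional as coefficient. *)
Lemma riesz (f : 'Hom(V, R^o)) : nondegenerate B -> exists u, forall v, B u v = f v.
Proof.
move=> ndB; case: (pselect (exists w x, B w x != 0)) => [[w [x wx]]|B0]; last first.
  have V0 (v : V) : v = 0.
    apply: ((nondegenerateP B).1 ndB) => u; apply/eqP/negPn/negP => vu.
    by apply: B0; exists v, u.
  by exists 0 => v; rewrite (V0 v) !linear0.
have fwL : linear (fun v => f v *: w).
  by move=> c y z; rewrite linearP scalerDl scalerA.
have [g gE] := lfun_of_linear fwL.
exists ((B w x)^-1 *: adjoint B g x) => v.
rewrite formZl (symC B (adjoint B g x)) -adjointP // gE formZl.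
by rewrite mulrCA mulVf ?mulr1.
Qed.

Lemma sharp_exists : nondegenerate B ->
  exists sharp : 'Hom('Hom(V, R^o), V), forall f v, B (sharp f) v = f v.
Proof.
move=> ndB; have /choice[S SE] f := riesz f ndB.
have [|sharp sharpE] := @lfun_of_linear _ _ _ S.
  move=> c f g; apply: (form_inj ndB) => v.
  by rewrite formDl formZl !SE add_lfunE scale_lfunE.
by exists sharp => f v; rewrite sharpE SE.
Qed.

Lemma gram (U W : vectType R) (x : 'Hom(U, V)) (y : 'Hom(W, V)) :
  exists K : 'Hom(U, 'Hom(W, R^o)), forall u w, K u w = B (x u) (y w).
Proof.
exists (lfun2 (fun u w => B (x u) (y w) : R^o)) => u w.
rewrite lfun2E // => v c a b; first by rewrite linearP formDr formZr.
by rewrite linearP formDl formZl.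
Qed.

End Riesz.

Definition trilinear (R : fieldType) (U V W : vectType R) (f : U -> V -> W -> R^o) :=
  [/\ forall v w, linear (fun u => f u v w), forall u w, linear (fun v => f u v w)
    & forall u v, linear (f u v)].

Lemma lfun3 (R : fieldType) (U V W : vectType R) (f : U -> V -> W -> R^o) :
  trilinear f -> exists g : 'Hom(U, 'Hom(V, 'Hom(W, R^o))),
  forall u v w, g u v w = f u v w.
Proof.
case=> fU fV fW.
have E u v w : linfun (f u v) w = f u v w.
  have [g gE] := lfun_of_linear (fW u v).
  have -> : f u v = g by apply/funext => x; rewrite gE.
  exact: lfunE.
exists (lfun2 (fun u v => linfun (f u v))) => u v w; rewrite lfun2E ?E //.
  by move=> x c y z; apply/lfunP => t; rewrite add_lfunE scale_lfunE !E fV.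
by move=> x c y z; apply/lfunP => t; rewrite add_lfunE scale_lfunE !E fU.
Qed.

(** This is how the bilinear maps [F], [G], [om] and [th] of the theorem are produced
    from the trilinear forms [B (u . v) w]. *)
Lemma riesz3 (R : fieldType) (U V W : vectType R) (B : {symmetric W})
    (f : U -> V -> W -> R^o) : nondegenerate B ->
  trilinear f -> exists g : 'Hom(U, 'Hom(V, W)),
  forall u v w, B (g u v) w = f u v w.
Proof.
move=> ndB /lfun3[g gE]; have [sharp sharpE] := sharp_exists ndB.
exists (lfun2 (fun u v => sharp (g u v))) => u v w.
rewrite lfun2E ?sharpE ?gE //; first by move=> x c y z; rewrite !linearP.
by move=> x c y z; rewrite linearP add_lfunE scale_lfunE linearP.
Qed.

(** * L-quadratic algebras *)

Section Operation.
Variables (R : fieldType) (V : vectType R) (m : product V) (op : V -> V -> V).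
Hypothesis mE : forall u v, m u v = op u v.

Lemma left_leibniz_op : left_leibniz m <->
  forall u v w, op u (op v w) = op (op u v) w + op v (op u w).
Proof. by split=> L u v w; have := L u v w; rewrite !mE. Qed.

Lemma L_quadratic_op (B : {symmetric V}) :
  L_quadratic m B <-> [/\ left_leibniz m, nondegenerate B
    & forall u v w, B (op u v) w = - B v (op u w)].
Proof.
by split=> [] [L nd sk]; split=> // u v w; have := sk u v w; rewrite !mE.
Qed.

End Operation.

Lemma L_quadratic_iso (R : fieldType) (V W : vectType R) (mV : product V)
    (BV : {symmetric V}) (mW : product W) (BW : {symmetric W}) :
  isomorphic mV BV mW BW -> L_quadratic mV BV -> L_quadratic mW BW.
Proof.
case=> phi [[psi phiK psiK] phiM phiB] [L nd sk].
split=> [u v w||u v w].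
- by rewrite -(psiK u) -(psiK v) -(psiK w) -!phiM L linearD.
- apply/nondegenerateP => u u0; rewrite -(psiK u).
  suff -> : psi u = 0 by rewrite linear0.
  by apply: ((nondegenerateP BV).1 nd) => v; rewrite -phiB psiK u0.
by rewrite -(psiK u) -(psiK v) -(psiK w) -!phiM !phiB sk.
Qed.

Lemma lie_left_leibniz (R : fieldType) (V : vectType R) (br : product V) :
  lie_algebra br -> left_leibniz br.
Proof.
case=> br0 jacobi u v w.
have brN x y : br x y = - br y x.
  apply/eqP; rewrite -addr_eq0; apply/eqP; have := br0 (x + y).
  by rewrite !linearD /= !add_lfunE !br0 add0r addr0 addrC.
apply/eqP; rewrite -subr_eq0 -(jacobi u v w) (brN (br u v)) (brN u w).
by rewrite linearN opprD !opprK addrA addrAC.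
Qed.

(** * The product on the sum of h, A and the dual of h *)

Section Extension.
Variables (R : fieldType) (h A : vectType R).
Variables (br : product h) (mA : product A) (BA : {symmetric A}).
Variables (F G : 'Hom(h, 'End(A))) (om th : 'Hom(h, 'Hom(h, A))).
Variable Om : 'Hom(h, 'Hom(h, 'Hom(h, R^o))).

Local Notation dual := 'Hom(h, R^o).
Local Notation ext := (h * A * dual)%type.
Local Notation M := (ext_mul br mA BA F G om th Om).
Local Notation E := (ext_form h BA).

Lemma mu0l b : mu BA G 0 b = 0.
Proof. by apply/lfunP => Z; rewrite muE linear0 linear0l oppr0 zero_lfunE. Qed.

Lemma mu0r a : mu BA G a 0 = 0.
Proof. by apply/lfunP => Z; rewrite muE linear0r oppr0 zero_lfunE. Qed.

Lemma nu0l a : nu BA th 0 a = 0.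
Proof. by apply/lfunP => Z; rewrite nuE lfun0l linear0l oppr0 zero_lfunE. Qed.

Lemma nu0r X : nu BA th X 0 = 0.
Proof. by apply/lfunP => Z; rewrite nuE linear0r oppr0 zero_lfunE. Qed.

Lemma rho0l X : rho BA om 0 X = 0.
Proof. by apply/lfunP => Z; rewrite rhoE linear0r oppr0 zero_lfunE. Qed.

Lemma rho0r a : rho BA om a 0 = 0.
Proof. by apply/lfunP => Z; rewrite rhoE lfun0l linear0l oppr0 zero_lfunE. Qed.

Lemma ad_dualE X alpha Y : ad_dual br X alpha Y = - alpha (br X Y).
Proof. by rewrite /ad_dual opp_lfunE comp_lfunE. Qed.

Lemma ad_dual0l alpha : ad_dual br 0 alpha = 0.
Proof. by apply/lfunP => Z; rewrite ad_dualE lfun0l linear0 oppr0 zero_lfunE. Qed.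

Lemma ad_dual0r X : ad_dual br X 0 = 0.
Proof. by apply/lfunP => Z; rewrite ad_dualE !zero_lfunE oppr0. Qed.

Definition zeroE := (mu0l, mu0r, nu0l, nu0r, rho0l, rho0r, ad_dual0l, ad_dual0r).
Definition dualE := (add_lfunE, muE, nuE, rhoE, ad_dualE).

Local Opaque mu nu rho ad_dual ext_mul.

(** The product is sealed: otherwise unification computes it on arbitrary arguments,
    and the multiplication table below cannot be used as a set of rewriting rules. *)
Definition ext_op := locked (ext_prod br mA BA F G om th Om).

Local Notation P := ext_op.
Local Notation iX X := ((X, 0, 0) : ext).
Local Notation iA a := ((0, a, 0) : ext).
Local Notation iD al := ((0, 0, al) : ext).

Lemma ext_opE u v : P u v = ext_prod br mA BA F G om th Om u v.
Proof. by rewrite /ext_op -lock. Qed.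

Lemma ext_mul_op u v : M u v = P u v.
Proof. by rewrite ext_mulE ext_opE. Qed.

Lemma ext_opDl u u' v : P (u + u') v = P u v + P u' v.
Proof. by rewrite !ext_opE -!ext_mulE linearD add_lfunE. Qed.

Lemma ext_opDr u v v' : P u (v + v') = P u v + P u v'.
Proof. by rewrite !ext_opE -!ext_mulE linearD. Qed.

Lemma extD X a al X' a' al' :
  ((X, a, al) : ext) + (X', a', al') = (X + X', a + a', al + al').
Proof. by []. Qed.

Lemma ext_split X a al : (X, a, al) = iX X + iA a + iD al.
Proof. by rewrite !extD !addr0 !add0r. Qed.

(* The multiplication table; the letters in a name are the summands of the factors. *)
Lemma prod_h X a al Y : P (X, a, al) (Y, 0, 0) =
  (br X Y, th X Y + G Y a, Om X Y + rho BA om a Y).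
Proof. by rewrite ext_opE /= !zeroE !linear0 !addr0. Qed.

Lemma prod_A X a al b : P (X, a, al) (0, b, 0) =
  (0, mA a b + F X b, mu BA G a b + nu BA th X b).
Proof. by rewrite ext_opE /= !zeroE !linear0 zero_lfunE !addr0 !add0r. Qed.

Lemma prod_d X a al be : P (X, a, al) (0, 0, be) = (0, 0, ad_dual br X be).
Proof. by rewrite ext_opE /= !zeroE !linear0 zero_lfunE !addr0 !add0r. Qed.

Lemma h_prod X Y b be : P (X, 0, 0) (Y, b, be) =
  (br X Y, th X Y + F X b, Om X Y + nu BA th X b + ad_dual br X be).
Proof. by rewrite ext_opE /= !zeroE !linear0 zero_lfunE !addr0. Qed.

Lemma A_prod a al Y b be : P (0, a, al) (Y, b, be) =
  (0, mA a b + G Y a, mu BA G a b + rho BA om a Y).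
Proof. by rewrite ext_opE /= !zeroE !linear0 !zero_lfunE !addr0 !add0r. Qed.

Lemma d_prod al v : P (0, 0, al) v = 0.
Proof. by case: v => [[Y b] be]; rewrite A_prod !zeroE lfun0l linear0 !addr0. Qed.

Lemma prod0l v : P 0 v = 0.
Proof. exact: d_prod. Qed.

Lemma prod0r u : P u 0 = 0.
Proof. by case: u => [[X a] al]; rewrite prod_d zeroE. Qed.

Lemma h_prod_h X Y : P (X, 0, 0) (Y, 0, 0) = (br X Y, th X Y, Om X Y).
Proof. by rewrite h_prod !zeroE linear0 !addr0. Qed.

Lemma h_prod_A X b be : P (X, 0, 0) (0, b, be) =
  (0, F X b, nu BA th X b + ad_dual br X be).
Proof. by rewrite h_prod !linear0 !add0r. Qed.

Lemma A_prod_A a al b be : P (0, a, al) (0, b, be) = (0, mA a b, mu BA G a b).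
Proof. by rewrite A_prod !zeroE linear0 zero_lfunE !addr0. Qed.

Lemma A_prod_h a al Y : P (0, a, al) (Y, 0, 0) = (0, G Y a, rho BA om a Y).
Proof. by rewrite A_prod !zeroE linear0 !add0r. Qed.

Definition tableE :=
  (h_prod_h, A_prod_A, A_prod_h, h_prod_A, prod_h, prod_A, h_prod, A_prod).

Lemma ext_eqP X a (al : dual) X' a' (al' : dual) (Q : h -> Prop) :
    (forall T, al T = al' T <-> Q T) ->
  ((X, a, al) : ext) = (X', a', al') <-> [/\ X = X', a = a' & forall T, Q T].
Proof.
move=> alQ; split=> [[-> -> e]|[-> -> q]].
  by split=> // T; apply/alQ; rewrite e.
by congr (_, _, _); apply/lfunP => T; apply/alQ/q.
Qed.

Lemma ext_eq0P a (al : dual) a' (al' : dual) (Q : h -> Prop) :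
    (forall T, al T = al' T <-> Q T) ->
  ((0, a, al) : ext) = (0, a', al') <-> a = a' /\ forall T, Q T.
Proof. by move=> /ext_eqP ->; split=> [[]|[]]. Qed.

(** * The Leibniz identity on elements of the summands *)

Definition leib u v w := P u (P v w) = P (P u v) w + P v (P u w).

Lemma leibDl u u' v w : leib u v w -> leib u' v w -> leib (u + u') v w.
Proof. by rewrite /leib => e e'; rewrite !(ext_opDl, ext_opDr) e e' addrACA. Qed.

Lemma leibDm u v v' w : leib u v w -> leib u v' w -> leib u (v + v') w.
Proof. by rewrite /leib => e e'; rewrite !(ext_opDl, ext_opDr) e e' addrACA. Qed.

Lemma leibDr u v w w' : leib u v w -> leib u v w' -> leib u v (w + w').
Proof. by rewrite /leib => e e'; rewrite !(ext_opDl, ext_opDr) e e' addrACA. Qed.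

Lemma leib_dl al v w : leib (iD al) v w.
Proof. by rewrite /leib !d_prod ?prod0l ?prod0r addr0. Qed.

Lemma leib_dm al u w : leib u (iD al) w.
Proof. by case: u => [[X a] be]; rewrite /leib prod_d !d_prod prod0r addr0. Qed.

(** [h] acts on its dual by the coadjoint representation, and [A] by zero. *)
Lemma leib_dr al u v : left_leibniz br -> leib u v (iD al).
Proof.
case: u v => [[X a] be] [[Y b] ga] Lbr.
rewrite /leib (ext_opE (X, a, be) (Y, b, ga)) /= !prod_d extD !addr0.
congr (_, _, _); apply/lfunP => T.
by rewrite !dualE !opprK (Lbr X) linearD /=; ring.
Qed.

Section Pure.
Hypothesis skA : forall a, skew_endo BA (mA a).
Hypothesis skF : forall X, skew_endo BA (F X).

Lemma mA_skewr a b c : BA b (mA a c) = - BA (mA a b) c.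
Proof. by rewrite skA opprK. Qed.

Lemma F_skewr X b c : BA b (F X c) = - BA (F X b) c.
Proof. by rewrite skF opprK. Qed.

Lemma leib_AAA a b c : leib (iA a) (iA b) (iA c) <->
  mA a (mA b c) = mA (mA a b) c + mA b (mA a c) /\
  forall T, BA (mA b (G T a)) c = BA (mA a (G T b) - G T (mA a b)) c.
Proof.
rewrite /leib !tableE ?extD ?(addr0, add0r); apply: ext_eq0P => T.
by apply: eq_iff_sub; rewrite !dualE !formE !mA_skewr; ring.
Qed.

Lemma leib_AAh a b X : leib (iA a) (iA b) (iX X) <->
  mA a (G X b) = G X (mA a b) + mA b (G X a) /\
  forall T, BA (- mA a (om X T)) b = BA (G T a) (G X b) - BA (G X a) (G T b).
Proof.
rewrite /leib !tableE ?extD ?(addr0, add0r); apply: ext_eq0P => T.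
by apply: eq_iff_sub; rewrite !dualE !formE !mA_skewr (symC BA (G T b)); ring.
Qed.

Lemma leib_AhA a X b : leib (iA a) (iX X) (iA b) <->
  mA a (F X b) = mA (G X a) b + F X (mA a b) /\
  forall T, BA (F X (G T a) + G T (G X a) - G (br X T) a) b =
    BA (mA a (th X T)) b.
Proof.
rewrite /leib !tableE ?extD ?(addr0, add0r); apply: ext_eq0P => T.
by apply: eq_iff_sub; rewrite !dualE !formE !mA_skewr !F_skewr; ring.
Qed.

Lemma leib_hAA X a b : leib (iX X) (iA a) (iA b) <->
  F X (mA a b) = mA (F X a) b + mA a (F X b) /\
  forall T, BA (mA a (th X T)) b =
    BA (F X (G T a) - G T (F X a) - G (br X T) a) b.
Proof.
rewrite /leib !tableE ?extD ?(addr0, add0r); apply: ext_eq0P => T.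
by apply: eq_iff_sub; rewrite !dualE !formE !mA_skewr !F_skewr; ring.
Qed.

Lemma leib_Ahh a X Y : leib (iA a) (iX X) (iX Y) <->
  mA a (th X Y) + G (br X Y) a = G Y (G X a) + F X (G Y a) /\
  forall T, BA (om (br X Y) T) a + BA (om Y (br X T)) a =
   BA (om Y T) (G X a) + BA (th X T) (G Y a) - BA (th X Y) (G T a).
Proof.
rewrite /leib !tableE ?extD ?zeroE ?(addr0, add0r); apply: ext_eq0P => T.
by apply: eq_iff_subN; rewrite !dualE (symC BA (G T a)); ring.
Qed.

Lemma leib_hAh X a Y : leib (iX X) (iA a) (iX Y) <->
  F X (G Y a) = G Y (F X a) + (mA a (th X Y) + G (br X Y) a) /\
  forall T, BA (om (br X Y) T) a + BA (om Y (br X T)) a =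
   BA (th X T) (G Y a) - BA (th X Y) (G T a) - BA (om Y T) (F X a).
Proof.
rewrite /leib !tableE ?extD ?zeroE ?(addr0, add0r); apply: ext_eq0P => T.
by apply: eq_iff_sub; rewrite !dualE (symC BA (G T a)); ring.
Qed.

Lemma leib_hhA X Y a : leib (iX X) (iX Y) (iA a) <->
  F X (F Y a) = mA (th X Y) a + F (br X Y) a + F Y (F X a) /\
  forall T, BA (th X (br Y T) - th (br X Y) T - th Y (br X T)
      + F X (th Y T) - F Y (th X T) - G T (th X Y)) a = 0.
Proof.
rewrite /leib !tableE ?extD ?zeroE ?(addr0, add0r); apply: ext_eq0P => T.
by apply: eq_iff_subN; rewrite !dualE !formE !F_skewr; ring.
Qed.

Lemma leib_hhh X Y Z : leib (iX X) (iX Y) (iX Z) <->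
 [/\ br X (br Y Z) = br (br X Y) Z + br Y (br X Z),
   th X (br Y Z) + F X (th Y Z) =
     th (br X Y) Z + G Z (th X Y) + (th Y (br X Z) + F Y (th X Z))
 & forall T, Delta br Om X Y Z T =
     BA (th X T) (th Y Z) - BA (th Y T) (th X Z) - BA (om Z T) (th X Y)].
Proof.
rewrite /leib !tableE !extD; apply: ext_eqP => T.
by apply: eq_iff_sub; rewrite /Delta /ad_form !dualE; ring.
Qed.

(** The 27 types of triples reduce to the eight ones without a factor in [h^*],
    since the Leibniz identity of [br] is part of the one of type [(h, h, h)]. *)
Lemma leib_pure :
  (forall u v w, leib u v w) <->
  left_leibniz br /\
  [/\ forall a b c, leib (iA a) (iA b) (iA c),
      forall a b X, leib (iA a) (iA b) (iX X),
      forall a X b, leib (iA a) (iX X) (iA b) &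
      forall X a b, leib (iX X) (iA a) (iA b)] /\
  [/\ forall a X Y, leib (iA a) (iX X) (iX Y),
      forall X a Y, leib (iX X) (iA a) (iX Y),
      forall X Y a, leib (iX X) (iX Y) (iA a) &
      forall X Y Z, leib (iX X) (iX Y) (iX Z)].
Proof.
split=> [L|[Lbr [[AAA AAh AhA hAA] [Ahh hAh hhA hhh]]]].
  split; last by do 2!split.
  by move=> X Y Z; have /leib_hhh[] := L (iX X) (iX Y) (iX Z).
move=> [[X a] al] [[Y b] be] [[Z c] ga].
rewrite (ext_split X) (ext_split Y) (ext_split Z).
apply: leibDl (leib_dl _ _ _); apply: leibDl; apply: leibDm (leib_dm _ _ _);
  apply: leibDm; apply: leibDr (leib_dr _ _ _ Lbr); exact: leibDr.
Qed.

Definition endE := (add_lfunE, opp_lfunE, comp_lfunE, rmulE).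

Hypothesis ndA : nondegenerate BA.

Lemma ext_left_leibniz : left_leibniz M <->
  [/\ left_leibniz br, left_leibniz mA, forall X, derivation mA (F X)
    & ext_compatible br mA BA F G om th Om].
Proof.
apply: iff_trans (left_leibniz_op ext_mul_op) _.
apply: iff_trans leib_pure _; split.
  case=> Lbr [[AAA AAh AhA hAA] [Ahh hAh hhA hhh]].
  split=> //.
  - by move=> a b c; have /leib_AAA[] := AAA a b c.
  - by move=> X a b; have /leib_hAA[] := hAA X a b.
  split.
  - move=> X a; apply/lfunP => b; rewrite /commutator !endE.
    by have /leib_AhA[-> _] := AhA a X b; rewrite addrK.
  - move=> X a; apply/lfunP => b; rewrite /commutator !endE.
    by have /leib_AAh[-> _] := AAh a b X; rewrite addrAC subrr add0r.
  - move=> X Y; apply/(lfun_formP ndA) => a b; rewrite !endE !formE.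
    have /leib_AAh[_ /(_ Y)] := AAh a b X; rewrite formE => ->.
    by rewrite !adjoint_formE.
  - move=> X Y; apply/(lfun_formP ndA) => a b; rewrite /commutator !endE.
    by have /leib_hAA[_ /(_ Y)] := hAA X a b.
  - move=> X Y; apply/(lfun_formP ndA) => a b; rewrite !endE.
    by have /leib_AhA[_ /(_ Y)] := AhA a X b.
  - move=> X Y; apply/lfunP => a; rewrite /commutator !endE.
    by have /leib_hhA[-> _] := hhA X Y a; rewrite addrK addrK.
  - move=> X Y Z; apply: ((nondegenerateP BA).1 ndA) => a.
    by have /leib_hhA[_ ->] := hhA X Y a.
  - move=> X Y Z; apply: ((nondegenerateP BA).1 ndA) => a.
    have /leib_hAh[_ /(_ Z)/eqP] := hAh X a Y; rewrite -subr_eq0 => /eqP <-.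
    by rewrite !formE !adjoint_formE // skF; ring.
  - move=> X Y Z; apply: ((nondegenerateP BA).1 ndA) => a.
    have /leib_hAh[_ /(_ Z)] := hAh X a Y.
    have /leib_Ahh[_ /(_ Z)->/eqP] := Ahh a X Y; rewrite -subr_eq0 => /eqP <-.
    by rewrite add_lfunE formE !adjoint_formE //; ring.
  - by move=> X Y Z T; have /leib_hhh[_ _ ->] := hhh X Y Z.
case=> Lbr LA dF [LF LG Rom Rth Rth' Lth cth com kom DOm].
have omA X Y a b : BA (- mA a (om X Y)) b = BA (G Y a) (G X b) - BA (G X a) (G Y b).
  have /(lfun_formP ndA)/(_ a b) := Rom X Y.
  by rewrite !endE !formE !adjoint_formE.
have com_hAh X Y Z a : BA (om (br X Y) Z) a + BA (om Y (br X Z)) a =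
    BA (th X Z) (G Y a) - BA (th X Y) (G Z a) - BA (om Y Z) (F X a).
  apply/eqP; rewrite -subr_eq0; apply/eqP; have := congr1 (BA^~ a) (com X Y Z).
  by rewrite /= linear0l !formE !adjoint_formE // skF => <-; ring.
have com_Ahh X Y Z a : BA (om Y Z) (F X a) = - BA (om Y Z) (G X a).
  apply/eqP; rewrite -subr_eq0; apply/eqP; have := congr1 (BA^~ a) (kom X Y Z).
  by rewrite /= linear0l add_lfunE formE !adjoint_formE // => <-; ring.
split=> //; split.
  split.
  - move=> a b c; apply/leib_AAA; split=> // T.
    by rewrite -(rmulE mA (G T a)) -LG /commutator !endE.
  - move=> a b X; apply/leib_AAh; split=> [|T]; last exact: omA.
    by rewrite -(rmulE mA (G X a)) -LG /commutator !endE addrC subrK.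
  - move=> a X b; apply/leib_AhA; split=> [|T].
      by rewrite -LF /commutator !endE subrK.
    by rewrite -(rmulE mA (th X T)) Rth' !endE.
  - move=> X a b; apply/leib_hAA; split=> [|T]; first exact: dF.
    by rewrite -(rmulE mA (th X T)) Rth /commutator !endE.
split.
- move=> a X Y; apply/leib_Ahh; split=> [|T].
    by rewrite -(rmulE mA (th X Y)) Rth' !endE subrK addrC.
  by rewrite com_hAh com_Ahh; ring.
- move=> X a Y; apply/leib_hAh; split=> [|T]; last exact: com_hAh.
  by rewrite -(rmulE mA (th X Y)) Rth /commutator !endE subrK addrC subrK.
- move=> X Y a; apply/leib_hhA; split=> [|T].
    by rewrite Lth /commutator !endE subrK subrK.
  by rewrite cth linear0l.
- move=> X Y Z; apply/leib_hhh; split=> //.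
  apply: (form_inj ndA) => a; apply/eqP; rewrite -subr_eq0; apply/eqP.
  by have := congr1 (BA^~ a) (cth X Y Z); rewrite /= linear0l !formE => <-; ring.
Qed.

End Pure.

(** * The metric on the sum *)

(** The terms defined by [mu], [nu], [rho] and the coadjoint action cancel against
    those defined by [G], [th] and [br]: this is what these maps are made for. *)
Lemma skew_defect u v w : E (P u v) w + E v (P u w) =
  let: (X, a, al) := u in let: (Y, b, be) := v in let: (Z, c, ga) := w in
  (Om X Y Z + Om X Z Y) - BA (om Y Z + om Z Y) a
  + (BA (mA a b) c + BA b (mA a c)) + (BA (F X b) c + BA b (F X c)).
Proof.
case: u v w => [[X a] al] [[Y b] be] [[Z c] ga].
rewrite !ext_opE /ext_form /= !dualE !formE.
by rewrite (symC BA b (th X Z)) (symC BA b (G Z a)); ring.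
Qed.

Definition form0E := (linear0l, linear0r, oppr0, addr0, add0r).

Lemma ext_skewP : nondegenerate BA ->
  (forall u v w, E (P u v) w = - E v (P u w)) <->
  [/\ forall a, skew_endo BA (mA a), forall X, skew_endo BA (F X),
      forall X Y, om X Y = - om Y X & forall X, alternating (Om X)].
Proof.
move=> ndA; split=> [sk|[skA skF omN OmN] u v w]; last first.
  apply/eqP; rewrite -addr_eq0 skew_defect.
  case: u v w => [[X a] al] [[Y b] be] [[Z c] ga].
  by rewrite OmN omN skA skF !addNr linear0l oppr0 !addr0.
have D u v w : E (P u v) w + E v (P u w) = 0 by rewrite sk addNr.
split.
- move=> a b c; have /eqP := D (iA a) (iA b) (iA c).
  by rewrite skew_defect !linear0 ?zero_lfunE !form0E addr_eq0 => /eqP.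
- move=> X a b; have /eqP := D (iX X) (iA a) (iA b).
  by rewrite skew_defect !linear0 ?zero_lfunE !form0E addr_eq0 => /eqP.
- move=> X Y; apply/eqP; rewrite -addr_eq0; apply/eqP.
  apply: ((nondegenerateP BA).1 ndA) => a; have /eqP := D (iA a) (iX X) (iX Y).
  by rewrite skew_defect !linear0 !zero_lfunE !form0E oppr_eq0 => /eqP.
- move=> X Y Z; have /eqP := D (iX X) (iX Y) (iX Z).
  by rewrite skew_defect !linear0 ?zero_lfunE !form0E addr_eq0 => /eqP.
Qed.

Lemma ext_nondegenerate : nondegenerate BA <-> nondegenerate (E : {symmetric ext}).
Proof.
split=> /nondegenerateP nd; apply/nondegenerateP.
  case=> [[X a] al] orth; congr (_, _, _).
  - apply: dual_separates => be; have := orth (0, 0, be).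
    by rewrite /ext_form /= !linear0 add0r addr0.
  - apply: nd => b; have := orth (0, b, 0).
    by rewrite /ext_form /= linear0 zero_lfunE !add0r.
  - apply/lfunP => Y; have := orth (Y, 0, 0).
    by rewrite /ext_form /= !zero_lfunE linear0 !addr0.
move=> a a0; suff [] : ((0, a, 0) : ext) = 0 by [].
apply: nd => -[[Y b] be].
by rewrite /ext_form /= !zero_lfunE linear0 !add0r.
Qed.

Theorem ext_L_quadratic : L_quadratic M E <->
  [/\ left_leibniz br, L_quadratic mA BA, ext_data mA BA F om Om
    & ext_compatible br mA BA F G om th Om].
Proof.
apply: iff_trans (L_quadratic_op ext_mul_op _) _.
split=> [[LM ndE skP]|[Lbr [LA ndA skA] [skF dF omN OmN] C]].
  have ndA := ext_nondegenerate.2 ndE.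
  have [skA skF omN OmN] := (ext_skewP ndA).1 skP.
  by have [Lbr LA dF C] := (ext_left_leibniz skA skF ndA).1 LM.
split.
- exact/(ext_left_leibniz skA skF ndA).
- exact/ext_nondegenerate.
- exact/(ext_skewP ndA).
Qed.

End Extension.

(** * From a splitting to an extension *)

Section Splitting.
Variables (R : fieldType) (V h A : vectType R).
Variables (m : product V) (B : {symmetric V}).
Variables (br : product h) (mA : product A) (BA : {symmetric A}).
Local Notation dual := 'Hom(h, R^o).
Local Notation ext := (h * A * dual)%type.
Variables (p : 'Hom(V, h)) (s : 'Hom(h, V)) (t : 'Hom(A, V)) (i : 'Hom(dual, V)).
Hypotheses (mB : L_quadratic m B) (ndA : nondegenerate BA).
Hypotheses (ps : forall X, p (s X) = X) (pt : forall a, p (t a) = 0).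
Hypothesis pi0 : forall al, p (i al) = 0.
Hypothesis iE : forall al v, B (i al) v = al (p v).
Hypotheses (ss : forall X Y, B (s X) (s Y) = 0) (st : forall X a, B (s X) (t a) = 0).
Hypothesis tt : forall a b, B (t a) (t b) = BA a b.
Hypothesis span : forall v, exists X a al, v = s X + t a + i al.
Hypothesis pM : forall u v, p (m u v) = br (p u) (p v).
Hypothesis tM : forall a b c, B (m (t a) (t b)) (t c) = BA (mA a b) c.
Hypothesis iM : forall al v, m (i al) v = 0.

Definition glue (u : ext) : V := let: (X, a, al) := u in s X + t a + i al.

Lemma glue_isometry u v : B (glue u) (glue v) = ext_form h BA u v.
Proof.
case: u v => [[X a] al] [[Y b] be] /=.
rewrite !formE !(symC B _ (i be)) !iE ?(ps, pt, pi0) ss st tt.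
by rewrite (symC B (t a)) st !linear0 ?(addr0, add0r); ring.
Qed.

Lemma glue_inj : injective glue.
Proof.
move=> [[X a] al] [[Y b] be] /= e; congr (_, _, _).
- by have := congr1 p e; rewrite !linearD /= !ps !pt !pi0 !addr0.
- apply: (form_inj ndA) => c; have := congr1 (B^~ (t c)) e.
  by rewrite /= !formDl !st !tt !iE !pt !linear0 !addr0 !add0r.
- apply/lfunP => Z; have := congr1 (B^~ (s Z)) e.
  by rewrite /= !formDl !ss !iE !ps !(symC B (t _)) !st !add0r.
Qed.

Lemma glue_linear : linear glue.
Proof.
move=> c [[X a] al] [[Y b] be].
rewrite /glue -[LHS]/(s (c *: X + Y) + t (c *: a + b) + i (c *: al + be)).
by rewrite !linearP !scalerDr (addrACA (c *: s X)) (addrACA (c *: s X + _)).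
Qed.

Lemma m_skew u v w : B (m u v) w = - B v (m u w).
Proof. by case: mB => _ _ sk; exact: sk. Qed.

(** A product pairs with [i al] through [p], so all that
    remains to be compared is its pairings with the images of [s] and [t]. *)
Lemma glue_mul (F G : 'Hom(h, 'End(A))) (om th : 'Hom(h, 'Hom(h, A)))
    (Om : 'Hom(h, 'Hom(h, dual))) :
    (forall X b c, BA (F X b) c = B (m (s X) (t b)) (t c)) ->
    (forall X a c, BA (G X a) c = B (m (t a) (s X)) (t c)) ->
    (forall X Y a, BA (om X Y) a = - B (m (t a) (s X)) (s Y)) ->
    (forall X Y c, BA (th X Y) c = B (m (s X) (s Y)) (t c)) ->
    (forall X Y Z, Om X Y Z = B (m (s X) (s Y)) (s Z)) ->
  forall u v w, ext_form h BA (ext_prod br mA BA F G om th Om u v) w =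
    B (m (glue u) (glue v)) (glue w).
Proof.
move=> FE GE omE thE OmE [[X a] al] [[Y b] be] [[Z c] ga].
have mi u be' w : B (m u (i be')) w = - be' (br (p u) (p w)).
  by rewrite m_skew iE pM.
have mDl x y z : m (x + y) z = m x z + m y z by rewrite linearD add_lfunE.
have mDr x y z : m z (x + y) = m z x + m z y by rewrite linearD.
have pD x a' al' : p (s x + t a' + i al') = x.
  by rewrite !linearD /= ps pt pi0 !addr0.
have pDst x a' : p (s x + t a') = x by rewrite linearD /= ps pt addr0.
have iEr x : B x (i ga) = ga (p x) by rewrite symC iE.
have swap x y z : B (m x y) z = - B (m x z) y by rewrite m_skew symC.
rewrite /= mDl iM addr0 mDr !formDl mi pD pDst.
rewrite !mDr !mDl !formE !iEr !pM !ps !pt !lfun0l !linear0.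
(* these two pairings are not free: they are the ones encoded by nu and mu *)
rewrite (swap (s X) (t b) (s Z)) (swap (t a) (t b) (s Z)).
by rewrite !dualE tM FE GE !thE omE OmE GE; ring.
Qed.

Lemma splitting_isomorphic : exists F G om th Om,
  isomorphic m B (ext_mul br mA BA F G om th Om) (ext_form h BA).
Proof.
have ndB : nondegenerate B by case: mB.
have [F FE] : exists F : 'Hom(h, 'End(A)), forall X b c,
    BA (F X b) c = B (m (s X) (t b)) (t c).
  apply: riesz3 => //; split=> [v w|u w|u v] c x y.
  - by rewrite !linearP add_lfunE scale_lfunE formDl formZl.
  - by rewrite !linearP formDl formZl.
  - by rewrite linearP formDr formZr.
have [G GE] : exists G : 'Hom(h, 'End(A)), forall X a c,
    BA (G X a) c = B (m (t a) (s X)) (t c).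
  apply: riesz3 => //; split=> [v w|u w|u v] c x y.
  - by rewrite !linearP formDl formZl.
  - by rewrite !linearP add_lfunE scale_lfunE formDl formZl.
  - by rewrite linearP formDr formZr.
have [om omE] : exists om : 'Hom(h, 'Hom(h, A)), forall X Y a,
    BA (om X Y) a = - B (m (t a) (s X)) (s Y).
  apply: riesz3 => //; split=> [v w|u w|u v] c x y.
  - by rewrite !linearP formDl formZl opprD -mulrN.
  - by rewrite linearP formDr formZr opprD -mulrN.
  - by rewrite !linearP add_lfunE scale_lfunE formDl formZl opprD -mulrN.
have [th thE] : exists th : 'Hom(h, 'Hom(h, A)), forall X Y c,
    BA (th X Y) c = B (m (s X) (s Y)) (t c).
  apply: riesz3 => //; split=> [v w|u w|u v] c x y.
  - by rewrite !linearP add_lfunE scale_lfunE formDl formZl.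
  - by rewrite !linearP formDl formZl.
  - by rewrite linearP formDr formZr.
have [Om OmE] : exists Om : 'Hom(h, 'Hom(h, dual)), forall X Y Z,
    Om X Y Z = B (m (s X) (s Y)) (s Z).
  apply: lfun3 => //; split=> [v w|u w|u v] c x y.
  - by rewrite !linearP add_lfunE scale_lfunE formDl formZl.
  - by rewrite !linearP formDl formZl.
  - by rewrite linearP formDr formZr.
have glueM := glue_mul FE GE omE thE OmE.
exists F, G, om, th, Om.
have /choice[psi psiK] : forall v, exists u, v = glue u.
  by move=> v; have [X [a [al ->]]] := span v; exists (X, a, al).
have glueK u : psi (glue u) = u by apply: glue_inj; rewrite -psiK.
have psiL : linear psi.
  by move=> c u v; rewrite [in LHS](psiK u) [in LHS](psiK v) -glue_linear glueK.
have [phi phiE] := lfun_of_linear psiL.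
have phi_fun : phi = psi :> (V -> ext) by apply/funext.
exists phi; rewrite phi_fun; split=> [|u v|u v].
- by exists glue => // v; rewrite -psiK.
- apply: glue_inj; rewrite -psiK ext_mulE; apply: (form_inj ndB) => w.
  by rewrite (psiK w) glue_isometry glueM -!psiK.
- by rewrite [in RHS](psiK u) [in RHS](psiK v) glue_isometry.
Qed.

Lemma splitting_extension :
  exists (F G : 'Hom(h, 'End(A))) (om th : 'Hom(h, 'Hom(h, A)))
         (Om : 'Hom(h, 'Hom(h, dual))),
  [/\ ext_data mA BA F om Om, ext_compatible br mA BA F G om th Om
    & isomorphic m B (ext_mul br mA BA F G om th Om) (ext_form h BA)].
Proof.
have [F [G [om [th [Om iso]]]]] := splitting_isomorphic.
have /ext_L_quadratic[_ _ dat compat] := L_quadratic_iso iso mB.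
by exists F, G, om, th, Om.
Qed.

End Splitting.

(** * Witt decomposition along an isotropic subspace *)

(** [h] and [A] stand for the quotients of [V] by [J] and of [J] by [I]. *)
Section Witt.
Variables (R : fieldType) (V h A : vectType R).
Variables (B : {symmetric V}) (BA : {symmetric A}) (I : {vspace V}).
Local Notation J := (orthov B I).
Local Notation dual := 'Hom(h, R^o).
Variables (p : 'Hom(V, h)) (r : 'Hom(subvs_of J, A)).
Hypothesis two_unit : 2%:R != 0 :> R.
Hypothesis ndB : nondegenerate B.
Hypothesis IJ : (I <= J)%VS.
Hypothesis p_surj : forall X, exists v, p v = X.
Hypothesis p_ker : forall v, p v = 0 <-> v \in J.
Hypothesis r_surj : forall a, exists x, r x = a.
Hypothesis r_ker : forall x, r x = 0 <-> vsval x \in I.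
Hypothesis rB : forall x y, BA (r x) (r y) = B (vsval x) (vsval y).

Lemma orthovC x y : x \in I -> y \in J -> B x y = 0.
Proof. by move=> xI /mem_orthovP yJ; rewrite symC yJ. Qed.

(** The functional [v |-> B (v - projv I v) w] vanishes on [I], so it is represented
    by a vector of [J]; its vanishing at [x] for all [w] means that [x] is in [I]. *)
Lemma orthov_orthov x : (forall y, y \in J -> B x y = 0) -> x \in I.
Proof.
move=> xJ; suff -> : x = projv I x by apply: memv_proj.
apply/eqP; rewrite -subr_eq0; apply/eqP.
apply: ((nondegenerateP B).1 ndB) => w.
have fL : linear (fun v => B (v - projv I v) w : R^o).
  by move=> c u v; rewrite linearP /= opprD addrACA -scalerBr formDl formZl.
have [f fE] := lfun_of_linear fL; have [w' w'E] := riesz f ndB.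
rewrite -fE -w'E symC; apply: xJ; apply/mem_orthovP => v vI.
by rewrite w'E fE projv_id // subrr linear0l.
Qed.

Lemma induced_nondegenerate : nondegenerate BA.
Proof.
apply/nondegenerateP => a a0; have [x ra] := r_surj a; rewrite -ra.
apply/r_ker/orthov_orthov => y yJ.
by have := a0 (r (vsproj J y)); rewrite -ra rB vsprojK.
Qed.

(** The dual of [h] embeds as [I] by the Riesz representation of the functionals
    [al \o p]. Arbitrary linear sections of [p] and [r] then become isotropic, and
    orthogonal to each other, after subtracting suitable values in [I], which pairs
    perfectly with any section of [p]. *)
Lemma witt_splitting : exists (s : 'Hom(h, V)) (t : 'Hom(A, V)) (i : 'Hom(dual, V)),
  [/\ [/\ forall X, p (s X) = X, forall a, t a \in J & forall al, i al \in I],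
      forall a, r (vsproj J (t a)) = a,
      forall al v, B (i al) v = al (p v),
      (forall X Y, B (s X) (s Y) = 0) /\ (forall X a, B (s X) (t a) = 0)
    & forall v, exists X a al, v = s X + t a + i al].
Proof.
have [sharp sharpE] := sharp_exists ndB.
have [i iE] : exists i : 'Hom(dual, V), forall al v, B (i al) v = al (p v).
  have [|i iE] := @lfun_of_linear _ _ _ (fun al : dual => sharp (al \o p)%VF).
    by move=> c al be; rewrite comp_lfunDl -comp_lfunZl linearP.
  by exists i => al v; rewrite iE sharpE comp_lfunE.
have iI al : i al \in I.
  by apply: orthov_orthov => y /p_ker py; rewrite iE py linear0.
have pJ x : x \in J -> p x = 0 by move/p_ker.
have IinJ x : x \in I -> x \in J by apply/subvP.
have pi0 al : p (i al) = 0 by apply/pJ/IinJ.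
have [s0 ps0] := linear_section p_surj.
have [t0 rt0] := linear_section r_surj.
have [K0 K0E] := gram B s0 s0.
(* the correction is halved because it enters B (s X) (s Y) once through each side *)
pose s := s0 - 2%:R^-1 *: (i \o K0)%VF.
have sE X : s X = s0 X - 2%:R^-1 *: i (K0 X).
  by rewrite add_lfunE opp_lfunE scale_lfunE comp_lfunE.
have ps X : p (s X) = X by rewrite sE linearB linearZ /= pi0 ps0 scaler0 subr0.
pose t1 := (linfun (vsval : subvs_of J -> V) \o t0)%VF.
have t1E a : t1 a = vsval (t0 a) by rewrite comp_lfunE lfunE.
have [K1 K1E] := gram B t1 s.
pose t := t1 - (i \o K1)%VF.
have tE a : t a = vsval (t0 a) - i (K1 a).
  by rewrite add_lfunE opp_lfunE !comp_lfunE lfunE.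
have rJ x : x \in I -> r (vsproj J x) = 0.
  by move=> xI; apply/r_ker; rewrite vsprojK // IinJ.
have rt a : r (vsproj J (t a)) = a.
  by rewrite tE linearB /= vsvalK linearB /= rt0 rJ ?subr0.
have tJ a : t a \in J by rewrite tE memvB ?subvsP // IinJ.
have ii x al : x \in J -> B (i al) x = 0 by move=> xJ; rewrite iE pJ ?linear0.
exists s, t, i; split=> //; first split=> [X Y|X a].
- rewrite !sE !formE !formZr !formZl (ii (i (K0 Y))) ?IinJ //.
  by rewrite (symC B _ (i _)) !iE !ps0 !K0E (symC B (s0 Y)); field.
- by rewrite tE formDr formNr (symC B _ (i _)) iE ps K1E t1E (symC B (s X)) subrr.
move=> v; pose w := v - s (p v).
have wJ : w \in J by apply/p_ker; rewrite linearB /= ps subrr.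
pose x := w - t (r (vsproj J w)).
have xI : x \in I.
  have xJ : x \in J by rewrite memvB.
  by rewrite -(vsprojK xJ); apply/r_ker; rewrite linearB /= linearB /= rt subrr.
have [K KE] := gram B \1%VF s.
exists (p v), (r (vsproj J w)), (K x).
suff <- : x = i (K x) by rewrite /x /w -[v - _ - _]addrA -opprD [RHS]addrC subrK.
apply: (form_inj ndB) => u; rewrite iE KE id_lfunE.
apply/eqP; rewrite -subr_eq0 -formNr -formDr orthovC //.
by apply/p_ker; rewrite linearB /= ps subrr.
Qed.

End Witt.

(** * The core *)

Section Core.
Variables (R : fieldType) (V : vectType R) (m : product V) (B : {symmetric V}).
Local Notation I := (core_I m B).
Local Notation J := (core_J m B).
Local Notation h := (core_h m B).
Local Notation A := (core_A m B).

Lemma core_I_isotropic : (I <= J)%VS.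
Proof.
apply/orthovP => x y; rewrite !memv_cap => /andP[_ /mem_orthovP xO] /andP[yL _].
exact: xO.
Qed.

Lemma core_h_projection : exists p : 'Hom(V, h),
  [/\ forall v, p v = pi_h m B v, forall X, exists v, p v = X
    & forall v, p v = 0 <-> v \in J].
Proof.
have [p pE] : exists p : 'Hom(V, h), forall v, p v = pi_h m B v.
  exact/lfun_of_linear/(vquot_pi_linear J).
exists p; split=> // [X|v].
  by exists (repr_h X); rewrite pE; exact: (reprK (X : vquot J)).
have -> : (p v = 0) = (pi_h m B v = pi_h m B 0) by rewrite -!pE linear0.
by rewrite -{2}[v]subr0; split=> /(vquot_eqP J).
Qed.

Lemma core_A_projection : exists r : 'Hom(subvs_of J, A),
  [/\ forall x, r x = pi_A x, forall a, exists x, r x = a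
    & forall x, r x = 0 <-> vsval x \in I].
Proof.
have [r rE] : exists r : 'Hom(subvs_of J, A), forall x, r x = pi_A x.
  exact/lfun_of_linear/(vquot_pi_linear (core_IJ m B)).
exists r; split=> // [a|x].
  by exists (repr_A a); rewrite rE; exact: (reprK (a : vquot (core_IJ m B))).
have memIJ : (x \in core_IJ m B) = (vsval x \in I) by rewrite -memv_preim lfunE.
have -> : (r x = 0) = (@pi_A _ _ m B x = pi_A 0) by rewrite -!rE linear0.
by rewrite -memIJ -{2}[x]subr0; split=> /(vquot_eqP (core_IJ m B)).
Qed.

Hypotheses (two_unit : 2%:R != 0 :> R) (mB : L_quadratic m B).

Lemma core_extension :
  exists (F G : 'Hom(h, 'End(A))) (om th : 'Hom(h, 'Hom(h, A)))
         (Om : 'Hom(h, 'Hom(h, 'Hom(h, R^o)))),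
  [/\ ext_data (core_mul m B) (core_form m B) F om Om,
      ext_compatible (core_br m B) (core_mul m B) (core_form m B) F G om th Om
    & isomorphic m B
        (ext_mul (core_br m B) (core_mul m B) (core_form m B) F G om th Om)
        (ext_form h (core_form m B))].
Proof.
have ndB : nondegenerate B by case: mB.
have [p [pE p_surj p_ker]] := core_h_projection.
have [r [rE r_surj r_ker]] := core_A_projection.
have rB x y : core_form m B (r x) (r y) = B (vsval x) (vsval y).
  by rewrite !rE core_formE.
have ndA := induced_nondegenerate ndB r_surj r_ker rB.
have [s [t [i [[ps tJ iI] rt iE [ss st] span]]]] :=
  witt_splitting two_unit ndB core_I_isotropic p_surj p_ker r_surj r_ker.
apply: (splitting_extension (p := p) (s := s) (t := t) (i := i)) => //.
- by move=> a; apply/p_ker.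
- by move=> al; apply/p_ker/(subvP core_I_isotropic).
- move=> a b; have := rB (vsproj J (t a)) (vsproj J (t b)).
  by rewrite !rt !vsprojK // => /esym.
- by move=> u v; rewrite !pE core_brE.
- move=> a b c; pose x a' := vsproj J (t a').
  have := core_mulE mB (x a) (x b); rewrite -!rE !rt => ->.
  have := rB (vsproj J (m (vsval (x a)) (vsval (x b)))) (x c).
  by rewrite rt /x !vsprojK ?core_J_mulr // rE => /esym.
- by move=> al v; rewrite (core_I_mul0 mB).
Qed.

End Core.

Theorem theorem5p1 (R : realType) :
  (forall (g : vectType R) (m : product g) (B : {symmetric g}),
     L_quadratic m B -> degenerate m B ->
     exists (F G : 'Hom(core_h m B, 'End(core_A m B)))
            (om th : 'Hom(core_h m B, 'Hom(core_h m B, core_A m B)))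
            (Om : 'Hom(core_h m B, 'Hom(core_h m B, 'Hom(core_h m B, R^o)))),
       [/\ ext_data (core_mul m B) (core_form m B) F om Om,
           ext_compatible (core_br m B) (core_mul m B) (core_form m B) F G om th Om
         & isomorphic m B
             (ext_mul (core_br m B) (core_mul m B) (core_form m B) F G om th Om)
             (ext_form (core_h m B) (core_form m B))]) /\
  (forall (h A : vectType R) (br : product h) (mA : product A) (BA : {symmetric A})
          (F G : 'Hom(h, 'End(A))) (om th : 'Hom(h, 'Hom(h, A)))
          (Om : 'Hom(h, 'Hom(h, 'Hom(h, R^o)))),
     L_quadratic mA BA -> lie_algebra br ->
     ext_data mA BA F om Om -> ext_compatible br mA BA F G om th Om ->
     L_quadratic (ext_mul br mA BA F G om th Om) (ext_form h BA)).
Proof.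
split=> [g m B mB _|h A br mA BA F G om th Om LA brL dat compat].
  by apply: core_extension mB; rewrite Num.Theory.pnatr_eq0.
apply: (ext_L_quadratic _ _ _ _ _ _ _ _).2.
by split=> //; apply: lie_left_leibniz.
Qed.
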